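(* Let $m\ge 1$ and $k\ge 2$ be integers. Then there exist (linearly) $k$-regular continuous maps $\mathbb{R}^m \to \mathbb{R}^{(m+1)(k-1)}$ and $\mathbb{C}^m \to \mathbb{C}^{(m+1)(k-1)}$.
   Context: For $\mathbb{F}\in\{\mathbb{R},\mathbb{C}\}$, a continuous map $f\colon \mathbb{F}^m\to\mathbb{F}^N$ is called (linearly) $k$-regular if for any $k$ pairwise distinct points $p_1,\dots,p_k\in\mathbb{F}^m$ the vectors $f(p_1),\dots,f(p_k)$ are linearly independent over $\mathbb{F}$ (i.e. span a $k$-dimensional linear subspace). *)

(* Defs.v *)
From HB Require Import structures.
From mathcomp Require Import all_boot all_order all_algebra.
From mathcomp Require Import all_classical all_reals all_analysis.
From mathcomp Require Import complex.
Set Implicit Arguments. Unset Strict Implicit. Unset Printing Implicit Defensive.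
Import Order.TTheory GRing.Theory Num.Theory.
Import numFieldNormedType.Exports.
Local Open Scope ring_scope.

(* F^n is modeled as row vectors 'rV[F]_n, with the product (sup-norm)
   topology coming from the normed structure of the number field F. *)

Definition k_regular (F : fieldType) (m N k : nat)
  (f : 'rV[F]_m -> 'rV[F]_N) : Prop :=
  forall p : 'I_k -> 'rV[F]_m, injective p ->
    free [seq f (p i) | i <- enum 'I_k].

(* Main.v *)
Require Import Defs.
From HB Require Import structures.
From mathcomp Require Import all_boot all_order all_algebra.
From mathcomp Require Import all_classical all_reals all_analysis.
From mathcomp Require Import complex.
From mathcomp Require Import -(notations) mpoly.
From mathcomp Require Import zify.
Import Order.TTheory GRing.Theory Num.Theory.
Import numFieldNormedType.Exports.
Local Open Scope ring_scope.
Local Open Scope complex_scope.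
Set Implicit Arguments. Unset Strict Implicit. Unset Printing Implicit Defensive.

(* For distinct points p_0, ..., p_{k-1} near 0 and coefficients c not all zero,
   put w = \sum_i c_i v(p_i - p_0), with v the Veronese map given by all monomials
   with exponents < k; then w <> 0, and \sum_i c_i v(p_i) = w T with T close to
   the identity. We want w T A <> 0 for a generic matrix A with N = (m+1)(k-1)
   columns. The vectors w depend on m(k-1) + k = N + 1 parameters, hence
   projectively on N, one too many. But as the points tend to 0, some coordinate t
   of p_1 - p_0 is nonzero and tends to 0, and limits of w lose a further dimension
   by an Abhyankar-type inequality: an algebraic relation between t and polynomials
   in w can be divided by a power of t and then reduced modulo t. So the limits of
   the lines spanned by w form a set of dimension at most N - 1, which the kernel
   of a generic A avoids; by compactness A works for all points in a small box.
   Finally F^m embeds continuously in that box. *)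

(** * Algebraic dependence *)

(** Polynomials of total degree below [D] involve at most [D ^ n] monomials, so the coefficient
    matrix of a larger family has a nonzero vector in its left kernel. *)
Lemma linear_dependence (F : fieldType) n D (I : finType) (g : I -> mpoly n F) :
  (forall i, (msize (g i) <= D)%N) -> (D ^ n < #|I|)%N ->
  exists2 a : I -> F, (exists i, a i != 0) & \sum_i a i *: g i = 0.
Proof.
move=> gD ltDI.
pose B := bmultinom n D.
have cardB : (#|{: B}| <= D ^ n)%N.
  have ltb (b : B) i : (bmnm b i < D)%N.
    by apply: leq_ltn_trans (bmdeg b); rewrite mdegE (bigD1 i) //= leq_addr.
  pose h (b : B) : {ffun 'I_n -> 'I_D} := [ffun i => Ordinal (ltb b i)].
  rewrite -[D in (D ^ _)%N]card_ord -[n in (_ ^ n)%N]card_ord -card_ffun.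
  apply: (leq_card h) => b c /ffunP bc; apply/val_inj/mnmP => i /=.
  by have /(congr1 val) := bc i; rewrite !ffunE.
pose G : 'M[F]_(#|I|, #|{: B}|) :=
  \matrix_(i, b) mcoeff (bmnm (enum_val b)) (g (enum_val i)).
have : kermx G != 0.
  rewrite kermx_eq0 /row_free neq_ltn; apply/orP; left.
  exact: leq_ltn_trans (rank_leq_col G) (leq_ltn_trans cardB ltDI).
case/rowV0Pn => u /sub_kermxP uG u0.
exists (fun i => u 0 (enum_rank i)).
  have /existsP[i ui] : [exists i, u 0 i != 0].
    apply: contraR u0; rewrite negb_exists => /forallP u0.
    by apply/eqP/rowP => i; rewrite mxE; apply/eqP; rewrite -[_ == _]negbK.
  by exists (enum_val i); rewrite enum_valK.
apply/mpolyP => s; rewrite mcoeff0 raddf_sum /=.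
under eq_bigr do rewrite mcoeffZ.
have [ltsD|leDs] := ltnP (mdeg s) D; last first.
  apply: big1 => i _; rewrite [mcoeff _ _]memN_msupp_eq0 ?mulr0 //.
  by apply/msize_mdeg_ge/(leq_trans (gD i)).
have /matrixP/(_ 0 (enum_rank (BMultinom ltsD))) := uG.
rewrite !mxE => uG0; rewrite -[RHS]uG0 (reindex enum_rank) /=.
  by apply: eq_bigr => i _; rewrite mxE !enum_rankK.
by apply: onW_bij; apply: enum_rank_bij.
Qed.

Lemma msize_exp_le (R : nzRingType) n (p : mpoly n R) r e :
  (msize p <= r)%N -> (msize (p ^+ e) <= e * r.+1 + 1)%N.
Proof.
move=> pr; elim: e => [|e IHe]; first by rewrite expr0 msize1.
rewrite exprS mulSn; apply: leq_trans (msizeM_le _ _) _.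
by move: pr IHe; set u := mmeasure _ p; set v := mmeasure _ (p ^+ e); lia.
Qed.

Lemma msize_prod_le (R : comNzRingType) n (I : finType) (g : I -> mpoly n R) r :
  (forall i, (msize (g i) <= r)%N) ->
  (msize (\prod_i g i)%R <= #|I| * r.+1 + 1)%N.
Proof.
move=> gr; rewrite -big_enum cardE.
elim: (enum I) => [|i s IHs]; first by rewrite big_nil msize1.
rewrite big_cons /= mulSn; apply: leq_trans (msizeM_le _ _) _.
by move: IHs (gr i); set u := mmeasure _ _; set v := mmeasure _ (g i); lia.
Qed.

(* There are more than [n] polynomials [f i], [t] in [n] variables, so they satisfy
   an algebraic relation; the powers of [t] common to all its terms are divided
   out, so that something nontrivial remains at [t = 0]. *)
Lemma residual_relation (F : fieldType) n n' (f : 'I_n' -> mpoly n F)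
    (t : mpoly n F) : (n <= n')%N ->
  exists e, exists2 H : nat -> mpoly n' F, H 0%N != 0 &
  forall x, meval x t != 0 ->
    \sum_(s < e.+1) meval x t ^+ s * meval (fun i => meval x (f i)) (H s) = 0.
Proof.
move=> len.
pose r := maxn (msize t) (\max_i msize (f i)).
have tr : (msize t <= r)%N by apply: leq_maxl.
have fr i : (msize (f i) <= r)%N.
  by apply: leq_trans (leq_maxr _ _); apply: (@leq_bigmax _ (fun i => msize (f i))).
(* The products [g i] will have size at most [c * d.+1], so they span a space of dimension at most
   [(c * d.+1) ^ n = d * d.+1 ^ n], because [d = c ^ n]. Their number [d.+1 * d.+1 ^ n'] is
   larger. *)
pose c := (n'.+1 * (r + 3) + 2)%N.
pose d := (c ^ n)%N.
pose I := ('I_d.+1 * {ffun 'I_n' -> 'I_d.+1})%type.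
pose g (i : I) := t ^+ i.1 * \prod_j f j ^+ i.2 j.
have gD i : (msize (g i) <= c * d.+1)%N.
  have h (p : mpoly n F) (u : 'I_d.+1) : (msize p <= r)%N -> (msize (p ^+ u) <= d * r.+1 + 1)%N.
    move=> pr; apply: leq_trans (msize_exp_le u pr) _.
    by rewrite leq_add2r leq_mul2r -ltnS ltn_ord orbT.
  have h1 := h _ i.1 tr.
  have h2 := msize_prod_le (fun j => h _ (i.2 j) (fr j)).
  apply: leq_trans (msizeM_le _ _) _; rewrite card_ord in h2.
  rewrite /c; move: h1 h2; set u := mmeasure _ _; set v := mmeasure _ _; nia.
have cI : ((c * d.+1) ^ n < #|{: I}|)%N.
  rewrite card_prod card_ffun !card_ord expnMn -/d.
  have le1 : (d.+1 ^ n <= d.+1 ^ n')%N by rewrite leq_pexp2l.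
  apply: leq_ltn_trans (leq_mul (leqnn d) le1) _.
  by rewrite ltn_mul2r ltnSn expn_gt0.
have [a [[e1 al] ae] sum0] := linear_dependence gD cI.
(* [H s] collects the coefficient of [t ^+ s]. Only indices [s <= d] enter the final sum, so the
   default value of [inord] beyond [d] is harmless. *)
pose H s : mpoly n' F := \sum_(al : {ffun 'I_n' -> 'I_d.+1})
   a (inord s, al) *: mpolyX F (Multinom [tuple val (al i) | i < n']).
have Hnz s : (H s != 0) = [exists al, a (inord s, al) != 0].
  apply/idP/idP => [|/existsP[be abe]].
    apply: contraNT; rewrite negb_exists => /forallP a0.
    apply/eqP/big1 => be _; move: (a0 be); rewrite negbK => /eqP ->.
    by rewrite scale0r.
  apply: contraNneq abe => /(congr1 (mcoeff (Multinom [tuple val (be i) | i < n']))).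
  rewrite mcoeff0 raddf_sum /= (bigD1 be) //= mcoeffZ mcoeffX eqxx mulr1.
  rewrite big1 ?addr0 => [->//|ga gabe]; rewrite mcoeffZ mcoeffX.
  case: eqP => [/mnmP ga_be|]; rewrite ?mulr0 //; case/eqP: gabe.
  by apply/ffunP => i; apply/val_inj; have := ga_be i; rewrite !mnmE.
have exH : exists s, (s < d.+1)%N && (H s != 0).
  exists e1; rewrite ltn_ord Hnz; apply/existsP; exists al.
  by rewrite inord_val.
case: (ex_minnP exH) => s0 /andP[s0d Hs0] s0min.
exists (d - s0)%N, (fun s => H (s0 + s)%N); first by rewrite addn0.
move=> x tx; apply: (mulfI (expf_neq0 s0 tx)); rewrite mulr0 mulr_sumr.
transitivity (meval x (\sum_i a i *: g i)); last by rewrite sum0 raddf0.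
rewrite raddf_sum /=.
transitivity (\sum_s \sum_j meval x (a (s, j) *: g (s, j))); last first.
  by rewrite pair_bigA /=; apply: eq_bigr => -[].
have Hev (s : 'I_d.+1) : \sum_j meval x (a (s, j) *: g (s, j)) =
    meval x t ^+ s * meval (fun i => meval x (f i)) (H s).
  rewrite /H raddf_sum mulr_sumr; apply: eq_bigr => be _ /=.
  rewrite !mevalZ inord_val /g mevalM rmorphXn /= rmorph_prod /= mevalX.
  rewrite mulrCA; congr (_ * (_ * _)); apply: eq_bigr => i _.
  by rewrite rmorphXn /= mnmE.
rewrite (eq_bigr _ (fun s _ => Hev s)).
rewrite -(big_mkord xpredT (fun s => meval x t ^+ s * meval (fun i => meval x (f i)) (H s))).
rewrite (big_cat_nat (n := s0)) //=; last exact: ltnW.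
rewrite [X in _ = X + _]big1_seq ?add0r => [|s]; last first.
  rewrite mem_index_iota => /= lts.
  case: (eqVneq (H s) 0) => [->|Hs]; first by rewrite raddf0 mulr0.
  by have := s0min s; rewrite Hs (ltn_trans lts s0d) leqNgt lts => /(_ isT).
rewrite -[X in index_iota X]add0n big_addn big_mkord subSn //; apply: eq_bigr => s _.
by rewrite mulrA -exprD addnC.
Qed.

(** * Nonvanishing of polynomials *)

Lemma base_expansion_inj n b (s s' : 'I_n -> nat) :
  (forall i, s i < b)%N -> (forall i, s' i < b)%N ->
  (\sum_i s i * b ^ i = \sum_i s' i * b ^ i)%N -> s =1 s'.
Proof.
elim: n s s' => [|n IHn] s s' sb s'b; first by move=> _ [].
have b_gt0 : (0 < b)%N by apply: leq_ltn_trans (sb ord0).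
have split_low (u : 'I_n.+1 -> nat) :
    (\sum_i u i * b ^ i = (\sum_(i < n) u (lift ord0 i) * b ^ i) * b + u ord0)%N.
  rewrite big_ord_recl expn0 muln1 addnC big_distrl /=; congr addn.
  by apply: eq_bigr => i _; rewrite -mulnA -expnSr.
rewrite !split_low => eq_ss'.
have eq0 : s ord0 = s' ord0.
  by have := congr1 (modn^~ b) eq_ss'; rewrite /= !modnMDl !modn_small.
move: eq_ss'; rewrite eq0 => /addIn/eqP.
rewrite eqn_pmul2r // => /eqP eqS i.
case: (unliftP ord0 i) => [j ->|-> //].
exact: (IHn (s \o lift ord0) (s' \o lift ord0) (fun=> sb _) (fun=> s'b _) eqS).
Qed.

(** In characteristic zero the integers below [size p] are distinct, and they are too many to be all
    roots. *)
Lemma poly_neq0_nonroot (F : numFieldType) (p : {poly F}) :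
  p != 0 -> exists x, p.[x] != 0.
Proof.
move=> p0; pose rs := [seq (i%:R : F) | i <- iota 0 (size p)].
have : ~~ all (root p) rs.
  apply/negP => /(max_poly_roots p0); rewrite size_map size_iota ltnn.
  rewrite map_inj_uniq ?iota_uniq => [/(_ isT)//|i j /eqP].
  by rewrite eqr_nat => /eqP.
by case/allPn => x _; rewrite rootE => px; exists x.
Qed.

(* Kronecker substitution: in base [msize p], the point [x_i = z ^ b ^ i]
   separates the monomials of [p]. *)
Lemma mpoly_neq0_nonroot (F : numFieldType) n (p : mpoly n F) :
  p != 0 -> exists x, meval x p != 0.
Proof.
move=> p0; pose b := msize p.
pose kr (s : multinom n) := (\sum_i s i * b ^ i)%N.
pose u : {poly F} := \sum_(s <- msupp p) mcoeff s p *: 'X^(kr s).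
have uE z : u.[z] = meval (fun i : 'I_n => z ^+ (b ^ i)) p.
  rewrite mevalE horner_sum; apply: eq_bigr => s _.
  rewrite hornerZ hornerXn; congr (_ * _).
  rewrite -prodrXr; apply: eq_bigr => i _.
  by rewrite -exprM mulnC.
suff /poly_neq0_nonroot[z uz] : u != 0 by exists (fun i => z ^+ (b ^ i)); rewrite -uE.
have ltb s i : s \in msupp p -> (s i < b)%N.
  move/msize_mdeg_lt; apply: leq_ltn_trans.
  by rewrite mdegE (bigD1 i) //= leq_addr.
have /hasP[s sp _] : has predT (msupp p).
  by rewrite has_predT lt0n size_eq0 msupp_eq0.
apply: contraTneq (sp) => /(congr1 (fun q : {poly F} => q`_(kr s))).
rewrite coef0 coef_sum mcoeff_msupp negbK => u0.
rewrite -[X in _ == X]u0 (bigD1_seq s) ?msupp_uniq //= coefZ coefXn eqxx mulr1.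
rewrite big1_seq ?addr0 // => s' /andP[s's s'p]; rewrite coefZ coefXn.
case: eqP => [/esym eqk|_]; rewrite ?mulr0 //; case/eqP: s's; apply/mnmP.
by apply: base_expansion_inj eqk => i; apply: ltb.
Qed.

(** A coordinate-free substitute for polynomial functions, directly applicable to the space of pairs
    [(y0, A)]. *)
Definition line_polynomial (F : numFieldType) (V : lmodType F) (g : V -> F) :=
  forall x d : V, exists u : {poly F}, forall s, g (x + s *: d) = u.[s].

(** Induction on the family: on the line joining a common nonroot of the earlier functions to a
    nonroot of the new one, each function restricts to a nonzero polynomial in one variable, and so
    the product of these restrictions has a nonroot. *)
Lemma common_nonroot (F : numFieldType) (V : lmodType F) (I : finType)
    (g : I -> V -> F) :
  (forall i, line_polynomial (g i)) -> (forall i, exists x, g i x != 0) ->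
  exists x, forall i, g i x != 0.
Proof.
move=> gl gx; suff: exists x, forall i, i \in enum I -> g i x != 0.
  by move=> [x xP]; exists x => i; apply: xP; rewrite mem_enum.
elim: (enum I) => [|j r [x IHx]]; first by exists 0.
have [y gy] := gx j.
have [U U0 UP] : exists2 U : {poly F}, U != 0 &
    forall s, U.[s] != 0 -> forall i, i \in r -> g i (x + s *: (y - x)) != 0.
  elim: r IHx => [|i r IHr] ix; first by exists 1; rewrite ?oner_eq0.
  have [|U U0 UP] := IHr; first by move=> l lr; apply: ix; rewrite inE lr orbT.
  have [v vE] := gl i x (y - x).
  exists (v * U) => [|s].
    rewrite mulf_neq0 //; apply: contraNneq (ix i (mem_head _ _)) => v0.
    by have := vE 0; rewrite scale0r addr0 => ->; rewrite v0 horner0.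
  rewrite hornerM mulf_eq0 negb_or -vE => /andP[gis Us] l.
  by rewrite inE => /predU1P[->//|]; apply: UP.
have [v vE] := gl j x (y - x).
have vU0 : v * U != 0.
  rewrite mulf_neq0 //; apply: contraNneq gy => v0.
  by have := vE 1; rewrite scale1r addrC subrK => ->; rewrite v0 horner0.
have [s] := poly_neq0_nonroot vU0.
rewrite hornerM mulf_eq0 negb_or -vE => /andP[gjs Us].
exists (x + s *: (y - x)) => i; rewrite inE => /predU1P[->//|].
exact: UP.
Qed.

(** * The Veronese map of multidegree less than k *)

Definition monomial m k (l : 'I_#|{ffun 'I_m -> 'I_k}|) : {ffun 'I_m -> 'I_k} :=
  enum_val l.

Definition veronese (R : comNzRingType) m k (x : 'rV[R]_m) :
    'rV[R]_#|{ffun 'I_m -> 'I_k}| :=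
  \row_l \prod_b x 0 b ^+ (monomial l b).
Arguments veronese {R m} k x.

Lemma map_veronese (R S : comNzRingType) (f : {rmorphism R -> S}) m k
    (x : 'rV[R]_m) : map_mx f (veronese k x) = veronese k (map_mx f x).
Proof.
apply/rowP => l; rewrite !mxE rmorph_prod; apply: eq_bigr => b _.
by rewrite rmorphXn /= mxE.
Qed.

(** The coefficient vector of a product of univariate polynomials, one in each coordinate, seen as a
    linear form on the Veronese space. *)
Definition veronese_form (R : comNzRingType) m k (g : 'I_m -> {poly R}) :
    'cV[R]_#|{ffun 'I_m -> 'I_k}| :=
  \col_l \prod_b (g b)`_(monomial l b).
Arguments veronese_form {R m} k g.

Lemma veronese_formE (R : comNzRingType) m k (g : 'I_m -> {poly R}) (x : 'rV_m) :
  (forall b, size (g b) <= k)%N ->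
  (veronese k x *m veronese_form k g) 0 0 = \prod_b (g b).[x 0 b].
Proof.
move=> gk; rewrite mxE.
transitivity (\prod_b \sum_(s < k) (g b)`_s * x 0 b ^+ s); last first.
  by apply: eq_bigr => b _; rewrite (horner_coef_wide _ (gk b)).
rewrite bigA_distr_bigA [RHS](reindex (@monomial m k)) /=; last first.
  exact: onW_bij (enum_val_bij _).
by apply: eq_bigr => l _; rewrite !mxE mulrC -big_split.
Qed.

(** Interpolation: each point other than [p i0] is assigned one coordinate in which it differs from
    [p i0], and [g b] has as roots the [b]-th coordinates of the points assigned to [b]. The product
    of the [g b] vanishes at all points except [p i0]; each [g b] has at most [k - 1] roots, hence
    size at most [k]. *)
Lemma veronese_indep (F : fieldType) m k (p : 'I_k -> 'rV[F]_m) (c : 'I_k -> F) :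
  injective p -> \sum_i c i *: veronese k (p i) = 0 -> forall i, c i = 0.
Proof.
move=> p_inj sum0 i0.
pose sep i := [pick b | p i 0 b != p i0 0 b].
have sep_i0 : sep i0 = None by rewrite /sep; case: pickP => // b; rewrite eqxx.
have sepP i : i != i0 -> exists2 b, sep i = Some b & p i 0 b != p i0 0 b.
  move=> ii0; rewrite /sep; case: pickP => [b|e]; first by exists b.
  case/eqP: ii0; apply/p_inj/rowP => b.
  by apply/eqP; rewrite -[_ == _]negbK; have /= -> := e b.
pose g b : {poly F} := \prod_(i | sep i == Some b) ('X - (p i 0 b)%:P).
have gk b : (size (g b) <= k)%N.
  rewrite /g -big_filter size_prod_XsubC size_filter -sum1_count.
  rewrite -[k in (_ <= k)%N]card_ord (eq_bigl (mem [pred i | sep i == Some b])) //.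
  rewrite sum1_card; apply: proper_card; apply/properP; split; first exact/fintype.subsetP.
  by exists i0; rewrite // inE sep_i0.
have gi i : i != i0 -> \prod_b (g b).[p i 0 b] = 0.
  move/sepP => [b sepb _]; rewrite (bigD1 b) //= /g horner_prod.
  by rewrite (bigD1 i) ?sepb //= hornerXsubC subrr !mul0r.
have gi0 : \prod_b (g b).[p i0 0 b] != 0.
  apply/prodf_neq0 => b _; rewrite horner_prod; apply/prodf_neq0 => i /eqP sepb.
  have ii0 : i != i0 by apply: contra_eq_neq sepb => ->; rewrite sep_i0.
  have [b' eqb' pb'] := sepP _ ii0.
  by move: sepb pb'; rewrite eqb' => -[->]; rewrite hornerXsubC subr_eq0 eq_sym.
have := congr1 (fun w => (w *m veronese_form k g) 0 0) sum0.
rewrite mul0mx mulmx_suml summxE (bigD1 i0) //= big1 ?addr0 => [|i ii0].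
  rewrite -scalemxAl mxE veronese_formE // mxE => /eqP.
  by rewrite mulf_eq0 (negPf gi0) orbF => /eqP.
by rewrite -scalemxAl mxE veronese_formE // gi // mulr0.
Qed.

(** Column [l] expands the monomial [l] at the shifted argument [x + p]. A shift does not raise
    exponents, so the bound [k] cuts nothing off. *)
Definition translation (R : comNzRingType) m k (p : 'rV[R]_m) :
    'M[R]_#|{ffun 'I_m -> 'I_k}| :=
  \matrix_(l', l) veronese_form k (fun b => ('X + (p 0 b)%:P) ^+ monomial l b) l' 0.
Arguments translation {R m} k p.

Lemma veronese_translation (R : comNzRingType) m k (p q : 'rV[R]_m) :
  veronese k (q + p) = veronese k q *m translation k p.
Proof.
apply/rowP => l; rewrite mxE.
have gk b : (size (('X + (p 0 b)%:P) ^+ monomial l b)%R <= k)%N.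
  apply: leq_trans (size_poly_exp_leq _ _) _.
  by rewrite size_XaddC mul1n.
transitivity (\prod_b (('X + (p 0 b)%:P) ^+ monomial l b).[q 0 b]).
  by apply: eq_bigr => b _; rewrite horner_exp hornerD hornerX hornerC mxE.
rewrite -(veronese_formE _ gk) !mxE; apply: eq_bigr => l' _.
by rewrite !mxE.
Qed.

Lemma translation0 (R : comNzRingType) m k : translation k (0 : 'rV[R]_m) = 1%:M.
Proof.
apply/matrixP => l' l; rewrite !mxE.
under eq_bigr do rewrite mxE addr0 coefXn.
have [->|ll'] := eqVneq l' l; first by apply: big1 => b _; rewrite eqxx.
have [b bP] : exists b, monomial l' b != monomial l b.
  apply/existsP; apply: contraR ll'; rewrite negb_exists => /forallP ll'.
  apply/eqP/enum_val_inj/ffunP => b; apply/eqP; rewrite -[_ == _]negbK; exact: ll'.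
by rewrite (bigD1 b) //= val_eqE (negPf bP) mul0r.
Qed.

(** * Algebraic relations for the vectors [w], and a generic matrix violating them *)

(** Evaluation points of the relations [H] below: [y0] is the entry [w_j], [y] is [w_j *: row j A]
    when [w *m A = 0], and [B] is [A] without row [j]. *)
Definition pack (R : nzRingType) N L (y0 : R) (y : 'rV[R]_N) (B : 'M[R]_(L, N)) :
    'rV[R]_(1 + N + L * N) :=
  row_mx (row_mx y0%:M y) (mxvec B).

Lemma map_pack (R S : nzRingType) (f : {rmorphism R -> S}) N L (y0 : R)
    (y : 'rV[R]_N) (B : 'M[R]_(L, N)) :
  map_mx f (pack y0 y B) = pack (f y0) (map_mx f y) (map_mx f B).
Proof. by rewrite /pack !map_row_mx map_mxvec map_scalar_mx. Qed.

(* If [w *m A = 0], then [- (col' j w *m row' j A) = w_j *: row j A]: in the limit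
   [t = 0] the relation becomes an algebraic condition on row [j] of [A] over the
   field generated by the other rows, which a generic [A] violates. *)
Lemma column_relation (F : fieldType) n N L (W : 'rV[mpoly n F]_L)
    (t : mpoly n F) (j : 'I_L) : (n <= N.+1)%N ->
  exists e, exists2 H : nat -> mpoly (1 + N + L.-1 * N) F, H 0%N != 0 &
  forall x (A : 'M[F]_(L, N)), let w := map_mx (meval x) W in meval x t != 0 ->
    \sum_(s < e.+1) meval x t ^+ s *
      meval (pack (w 0 j) (- (col' j w *m row' j A)) (row' j A) 0) (H s) = 0.
Proof.
(* The [K] entries of [row' j A] are adjoined as independent variables, so that [H] does not depend
   on [A]. They add [K] both to the variables and to the polynomials, so the count still rests on
   [n <= N.+1]. *)
move=> lenN; pose K := (L.-1 * N)%N.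
pose X : n.-tuple (mpoly (n + K) F) := [tuple mpolyX F (mnm1 (lshift K i)) | i < n].
pose W' := map_mx (comp_mpoly X) W.
pose B : 'M[mpoly (n + K) F]_(L.-1, N) :=
  vec_mx (\row_i mpolyX F (mnm1 (rshift n i))).
pose f := pack (W' 0 j) (- (col' j W' *m B)) B.
have le_n : (n + K <= 1 + N + K)%N by rewrite leq_add2r.
have [e [H H0 Hrel]] := residual_relation (f 0) (comp_mpoly X t) le_n.
exists e, H => // x A w tx.
pose z := row_mx (\row_i x i) (mxvec (row' j A)) 0.
have compE p : meval z (comp_mpoly X p) = meval x p.
  rewrite comp_mpoly_meval; apply: meval_eq => i.
  by rewrite tnth_mktuple mevalXU /z row_mxEl mxE.
have W'E : map_mx (meval z) W' = w.
  by apply/rowP => l; rewrite !mxE compE.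
have BE : map_mx (meval z) B = row' j A.
  rewrite map_vec_mx -[RHS]mxvecK; congr vec_mx.
  by apply/rowP => l; rewrite !mxE mevalXU /z row_mxEr.
have fE : map_mx (meval z) f = pack (w 0 j) (- (col' j w *m row' j A)) (row' j A).
  have W'j : meval z (W' 0 j) = w 0 j by rewrite -W'E [RHS]mxE.
  by rewrite map_pack map_mxN map_mxM map_col' BE W'E /= W'j.
rewrite -[RHS](Hrel z) compE //; apply: eq_bigr => s _; congr (_ * _).
by apply: meval_eq => i; rewrite -fE mxE.
Qed.

(** The vector [w] of [k.+1] points after the first one is moved to 0, which saves [m]
    parameters. *)
Definition pointed_sum (R : comNzRingType) m k (c : 'rV[R]_k.+1) (q : 'M[R]_(k, m)) :
    'rV[R]_#|{ffun 'I_m -> 'I_k.+1}| :=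
  c 0 ord0 *: veronese k.+1 0 + \sum_i c 0 (lift ord0 i) *: veronese k.+1 (row i q).

Lemma map_pointed_sum (R S : comNzRingType) (f : {rmorphism R -> S}) m k
    (c : 'rV[R]_k.+1) (q : 'M[R]_(k, m)) :
  map_mx f (pointed_sum c q) = pointed_sum (map_mx f c) (map_mx f q).
Proof.
rewrite /pointed_sum map_mxD map_mxZ map_veronese map_mx0 raddf_sum /= !mxE.
congr (_ + _); apply: eq_bigr => i _.
by rewrite map_mxZ map_veronese map_row mxE.
Qed.

(** The parameters are the [k * m] coordinates of [q] and the [k.+1] coefficients, exactly [N.+1] in
    all: this count is what the target dimension [N] has to match. The small parameter [t] is the
    entry [q i b]. *)
Lemma pointed_relation (F : fieldType) m k (i : 'I_k) (b : 'I_m)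
    (j : 'I_#|{ffun 'I_m -> 'I_k.+1}|) :
  let N := (m.+1 * k)%N in
  exists e, exists2 H : nat -> mpoly (1 + N + _ * N) F, H 0%N != 0 &
  forall c q (A : 'M[F]_(_, N)), let w := pointed_sum c q in q i b != 0 ->
    \sum_(s < e.+1) q i b ^+ s *
      meval (pack (w 0 j) (- (col' j w *m row' j A)) (row' j A) 0) (H s) = 0.
Proof.
move=> N; pose n := (k * m + k.+1)%N.
pose X : 'rV[mpoly n F]_(k * m + k.+1) := \row_i mpolyX F (mnm1 i).
pose C := rsubmx X; pose Q : 'M[mpoly n F]_(k, m) := vec_mx (lsubmx X).
have leN : (n <= N.+1)%N by rewrite /n /N; lia.
have [e [H H0 Hrel]] := column_relation (pointed_sum C Q) (Q i b) j leN.
exists e, H => // c q A w qib.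
pose x := row_mx (mxvec q) c 0.
have XE : map_mx (meval x) X = row_mx (mxvec q) c.
  by apply/rowP => l; rewrite [LHS]mxE [X in meval _ X]mxE mevalXU.
have CE : map_mx (meval x) C = c by rewrite map_rsubmx XE row_mxKr.
have QE : map_mx (meval x) Q = q by rewrite map_vec_mx map_lsubmx XE row_mxKl mxvecK.
have Qib : meval x (Q i b) = q i b by rewrite -[in RHS]QE [RHS]mxE.
by have := Hrel x A; rewrite map_pointed_sum CE QE Qib; apply.
Qed.

(* The relations are not made homogeneous in [w]; instead [w] is normalised by
   [w_j = y0] for a scalar [y0] that is chosen generic together with [A]. *)
Lemma generic_matrix (F : numFieldType) N L (I : finType) (j : I -> 'I_L)
    (H : I -> mpoly (1 + N + L.-1 * N) F) : (forall i, H i != 0) ->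
  exists (y0 : F) (A : 'M[F]_(L, N)), y0 != 0 /\
    forall i, meval (pack y0 (y0 *: row (j i) A) (row' (j i) A) 0) (H i) != 0.
Proof.
move=> H0; pose V := (F^o * 'M[F]_(L, N))%type.
(* The factor [v.1] forces [y0 != 0] at a common nonroot. *)
pose g (i : I) (v : V) :=
  v.1 * meval (pack v.1 (v.1 *: row (j i) v.2) (row' (j i) v.2) 0) (H i).
have gl i : line_polynomial (g i).
  move=> [x A] [d D].
  pose lx : {poly F} := x%:P + d *: 'X.
  pose lA : 'M[{poly F}]_(L, N) := map_mx polyC A + 'X *: map_mx polyC D.
  pose lp := pack lx (lx *: row (j i) lA) (row' (j i) lA) 0.
  exists (lx * \sum_(s <- msupp (H i)) (mcoeff s (H i))%:P * \prod_l lp l ^+ s l).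
  move=> s.
  have lxE : lx.[s] = x + s * d by rewrite /lx hornerD hornerC hornerZ hornerX mulrC.
  have lAE : map_mx (horner_eval s) lA = A + s *: D.
    apply/matrixP => l l'; rewrite !mxE /horner_eval.
    by rewrite hornerD hornerC hornerM hornerX hornerC.
  have lpE l : (lp l).[s] =
      pack (x + s * d) ((x + s * d) *: row (j i) (A + s *: D))
        (row' (j i) (A + s *: D)) 0 l.
    rewrite -lAE -lxE -[lx.[s]]/(horner_eval s lx).
    rewrite -map_row -map_row' -map_mxZ -map_pack.
    by rewrite [RHS]mxE.
  rewrite hornerM lxE /g /=; congr (_ * _); rewrite mevalE horner_sum.
  apply: eq_bigr => u _; rewrite hornerM hornerC horner_prod; congr (_ * _).
  by apply: eq_bigr => l _; rewrite horner_exp lpE.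
have gx i : exists v, g i v != 0.
  (* A nonroot [z] of [H i] with [z z0 != 0] comes from a pair [(y0, A)]: row [j i] of [A] is the
     middle block of [z] divided by [z z0]. *)
  pose z0 : 'I_(1 + N + L.-1 * N) := lshift _ (lshift N ord0).
  have : mpolyX F (mnm1 z0) * H i != 0.
    by rewrite mulf_neq0 // -msize_poly_eq0 msizeX.
  case/mpoly_neq0_nonroot => z; rewrite mevalM mevalXU mulf_eq0 negb_or => /andP[z00 Hz].
  pose zr : 'rV[F]_(1 + N + L.-1 * N) := \row_l z l.
  pose B : 'M[F]_(L.-1, N) := vec_mx (rsubmx zr).
  pose A : 'M[F]_(L, N) := \matrix_(l, l')
    if unlift (j i) l is Some l1 then B l1 l' else (z z0)^-1 * rsubmx (lsubmx zr) 0 l'.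
  exists (z z0, A); rewrite /g mulf_neq0 //=.
  have rowA : z z0 *: row (j i) A = rsubmx (lsubmx zr).
    by apply/rowP => l; rewrite !mxE unlift_none mulrA divff // mul1r.
  have row'A : row' (j i) A = B by apply/matrixP => l l'; rewrite 2![LHS]mxE liftK.
  rewrite rowA row'A (meval_eq (v2 := z)) // => l.
  rewrite /pack vec_mxK.
  have -> : (z z0)%:M = lsubmx (lsubmx zr).
    by apply/matrixP => u v; rewrite !ord1 !mxE eqxx mulr1n.
  by rewrite !hsubmxK mxE.
have [[y0 A] yA] := common_nonroot gl gx.
(* [y0 != 0] is read off any single index; an empty [I] requires a separate choice. *)
have [i0 _|I0] := pickP (mem I).
  exists y0, A; split => [|i].
    by apply: contraNneq (yA i0) => y00; rewrite /g /= y00 mul0r.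
  by have := yA i; rewrite mulf_eq0 negb_or => /andP[].
by exists 1, 0; split=> [|i]; [apply: oner_neq0|have := I0 i].
Qed.

(** * Local regularity by compactness *)

Local Open Scope classical_set_scope.

Lemma cvg_bigsum (F : numFieldType) T (G : set_system T) (I : Type) (r : seq I)
    (P : pred I) (f : I -> T -> F) (l : I -> F) : Filter G ->
  (forall i, f i @ G --> l i) ->
  (fun t => \sum_(i <- r | P i) f i t) @ G --> \sum_(i <- r | P i) l i.
Proof.
move=> FG fl; elim: r => [|i r IHr].
  under eq_fun do rewrite big_nil; rewrite big_nil; exact: cvg_cst.
under eq_fun do rewrite big_cons; rewrite big_cons.
by case: (P i) => //; apply: cvgD.
Qed.

Lemma cvg_bigprod (F : numFieldType) T (G : set_system T) (I : Type) (r : seq I)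
    (P : pred I) (f : I -> T -> F) (l : I -> F) : Filter G ->
  (forall i, f i @ G --> l i) ->
  (fun t => \prod_(i <- r | P i) f i t) @ G --> \prod_(i <- r | P i) l i.
Proof.
move=> FG fl; elim: r => [|i r IHr].
  under eq_fun do rewrite big_nil; rewrite big_nil; exact: cvg_cst.
under eq_fun do rewrite big_cons; rewrite big_cons.
by case: (P i) => //; apply: cvgM.
Qed.

Lemma cvg_exprn (F : numFieldType) T (G : set_system T) (f : T -> F) (l : F) n :
  Filter G -> f @ G --> l -> (fun t => f t ^+ n) @ G --> l ^+ n.
Proof.
move=> FG fl; elim: n => [|n IHn].
  under eq_fun do rewrite expr0; rewrite expr0; exact: cvg_cst.
under eq_fun do rewrite exprS; rewrite exprS; exact: cvgM.
Qed.

Lemma cvg_meval (F : numFieldType) T (G : set_system T) n (p : mpoly n F)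
    (f : T -> 'I_n -> F) (l : 'I_n -> F) : Filter G ->
  (forall i, f^~ i @ G --> l i) ->
  (fun t => meval (f t) p) @ G --> meval l p.
Proof.
move=> FG fl; rewrite mevalE; under eq_fun do rewrite mevalE.
apply: cvg_bigsum => s; apply: cvgM; first exact: cvg_cst.
by apply: cvg_bigprod => i; apply: cvg_exprn.
Qed.

Lemma cvg_mulmx_entry (F : numFieldType) T (G : set_system T) m n p
    (A : T -> 'M[F]_(m, n)) (B : T -> 'M[F]_(n, p))
    (A0 : 'M[F]_(m, n)) (B0 : 'M[F]_(n, p)) : Filter G ->
  (forall i j, (fun t => A t i j) @ G --> (A0 i j : F)) ->
  (forall i j, (fun t => B t i j) @ G --> (B0 i j : F)) ->
  forall i j, (fun t => (A t *m B t) i j) @ G --> ((A0 *m B0) i j : F).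
Proof.
move=> FG fA fB i j; rewrite mxE; under eq_fun do rewrite mxE.
by apply: cvg_bigsum => l; apply: cvgM.
Qed.

Lemma cvg_entries (F : numFieldType) T (G : set_system T) m n
    (A : T -> 'M[F]_(m, n)) (A0 : 'M[F]_(m, n)) : Filter G ->
  (forall i j, (fun t => A t i j) @ G --> (A0 i j : F)) -> A @ G --> A0.
Proof.
move=> FG fA U [P Pn PU].
have : \forall t \near G, forall i j, P i j (A t i j).
  by apply: filter_forall => i; apply: filter_forall => j; apply: fA; apply: Pn.
by apply: filterS => t; apply: PU.
Qed.

Lemma cvg_coef_shift (F : numFieldType) T (G : set_system T) (f : T -> F) (l : F)
    n d : Filter G -> f @ G --> l ->
  (fun t => (('X + (f t)%:P) ^+ n)`_d) @ G --> ((('X + l%:P) ^+ n)`_d : F).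
Proof.
move=> FG fl; elim: n d => [|n IHn] d.
  under eq_fun do rewrite expr0; rewrite expr0; exact: cvg_cst.
rewrite exprS mulrDl coefD coefXM coefCM.
under eq_fun do rewrite exprS mulrDl coefD coefXM coefCM.
by apply: cvgD; [case: eqP => _ //; exact: cvg_cst|exact: cvgM].
Qed.

Lemma cvg_translation (F : numFieldType) T (G : set_system T) m k
    (p : T -> 'rV[F]_m) (p0 : 'rV[F]_m) : Filter G ->
  (forall b, (fun t => p t 0 b) @ G --> (p0 0 b : F)) ->
  forall i j, (fun t => translation k (p t) i j) @ G --> (translation k p0 i j : F).
Proof.
move=> FG fp i j; rewrite !mxE; under eq_fun do rewrite !mxE.
by apply: cvg_bigprod => b; apply: cvg_coef_shift.
Qed.

Lemma cvg_pack (F : numFieldType) T (G : set_system T) N L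
    (y : T -> F) (z : T -> 'rV[F]_N) (B : 'M[F]_(L, N)) (y0 : F)
    (z0 : 'rV[F]_N) : Filter G ->
  y @ G --> y0 -> (forall i, (fun t => z t 0 i) @ G --> (z0 0 i : F)) ->
  forall i, (fun t => pack (y t) (z t) B 0 i) @ G --> (pack y0 z0 B 0 i : F).
Proof.
move=> FG fy fz i; rewrite mxE; under eq_fun do rewrite mxE.
case: (fintype.split i) => {}i; last exact: cvg_cst.
rewrite mxE; under eq_fun do rewrite mxE.
case: (fintype.split i) => {}i; last exact: fz.
rewrite (ord1 i) mxE eqxx mulr1n.
by under eq_fun do rewrite mxE eqxx mulr1n.
Qed.

(* The set of normalised [w] is compact, so it is enough to check that at [v = 0]
   no [w] satisfies the three conditions, each of which is closed in [(v, w)]. *)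
Lemma near_no_dependence (F : numFieldType) m k N
    (A : 'M[F]_(#|{ffun 'I_m -> 'I_k}|, N)) j y0 e
    (H : nat -> mpoly (1 + N + #|{ffun 'I_m -> 'I_k}|.-1 * N) F) (K : set F) :
  compact K ->
  meval (pack y0 (y0 *: row j A) (row' j A) 0) (H 0%N) != 0 ->
  \forall v \near nbhs (0 : F * 'rV[F]_m),
    forall w : 'rV[F]_(#|{ffun 'I_m -> 'I_k}|), (forall l, K (w 0 l)) ->
    w 0 j = y0 -> w *m (translation k v.2 *m A) = 0 ->
    \sum_(s < e.+1) v.1 ^+ s *
      meval (pack (w 0 j) (- (col' j w *m row' j A)) (row' j A) 0) (H s) != 0.
Proof.
move=> cpt H0; set L := #|_|.
have cptK : compact [set w : 'rV[F]_L | forall l, K (w ord0 l)].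
  exact: (rV_compact (fun=> cpt)).
pose P (v : F * 'rV[F]_m) (w : 'rV[F]_L) :=
  w 0 j = y0 -> w *m (translation k v.2 *m A) = 0 ->
    \sum_(s < e.+1) v.1 ^+ s *
      meval (pack (w 0 j) (- (col' j w *m row' j A)) (row' j A) 0) (H s) != 0.
suff : \forall v \near nbhs (0 : F * 'rV[F]_m),
    [set w : 'rV[F]_L | forall l, K (w ord0 l)] `<=` P v.
  by apply: filterS => v vP w wK wj wA; exact: vP.
(* Compactness reduces the claim to neighbourhoods of the points [(w0, 0)]. *)
move/compact_near_coveringP: cptK; apply=> w0 w0K.
pose G := filter_prod (nbhs w0) (nbhs (0 : F * 'rV[F]_m)).
suff : \forall x \near G, P x.2 x.1 by [].
have FG : Filter G by exact: filter_prod_filter.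
have c1 : fst @ G --> w0 by exact: cvg_fst.
have c2 : snd @ G --> (0 : F * 'rV[F]_m) by exact: cvg_snd.
have cw l : (fun x : 'rV[F]_L * (F * 'rV[F]_m) => x.1 0 l) @ G --> (w0 0 l : F).
  exact: (cvg_comp _ _ c1 (@coord_continuous F 1 L 0 l w0)).
have ct : (fun x : 'rV[F]_L * (F * 'rV[F]_m) => x.2.1) @ G --> (0 : F).
  apply: (cvg_comp _ _ c2); exact: cvg_fst.
have c3 : (fun x : 'rV[F]_L * (F * 'rV[F]_m) => x.2.2) @ G --> (0 : 'rV[F]_m).
  apply: (cvg_comp _ _ c2); exact: cvg_snd.
have cp b : (fun x : 'rV[F]_L * (F * 'rV[F]_m) => x.2.2 0 b) @ G --> ((0 : 'rV[F]_m) 0 b : F).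
  exact: (cvg_comp _ _ c3 (@coord_continuous F 1 m 0 b 0)).
have nz (h : 'rV[F]_L * (F * 'rV[F]_m) -> F) (l : F) :
    h @ G --> l -> l != 0 -> \forall x \near G, h x != 0.
  by move=> hl l0; exact: cvgr_neq0 hl l0.
have [w0j|w0j] := eqVneq (w0 0 j) y0; last first.
  have w0j' : w0 0 j - y0 != 0 by rewrite subr_eq0.
  apply: filterS (nz (fun x => x.1 0 j - y0) _ _ w0j') => [x|].
    by rewrite subr_eq0 => /eqP xj xj0; case: xj.
  by apply: cvgB; [exact: cw|exact: cvg_cst].
have [w0A|] := eqVneq (w0 *m A) 0; last first.
  case/rV0Pn => l w0l.
  apply: filterS (nz (fun x => (x.1 *m (translation k x.2.2 *m A)) 0 l) _ _ w0l) => [x xl _ xA|].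
    by rewrite xA mxE eqxx in xl.
  rewrite -[A in (_ *m A) 0 l]mul1mx -translation0.
  apply: cvg_mulmx_entry => i i'; first by rewrite ord1.
  apply: cvg_mulmx_entry => {}i {}i'; last exact: cvg_cst.
  exact: cvg_translation.
pose S t (w : 'rV[F]_L) := \sum_(s < e.+1) t ^+ s *
  meval (pack (w 0 j) (- (col' j w *m row' j A)) (row' j A) 0) (H s).
(* At [t = 0] only the term [s = 0] survives, and [w0 *m A = 0] turns its argument into the point at
   which [H 0] is nonzero by hypothesis. *)
have S0 : S 0 w0 != 0.
  rewrite /S big_ord_recl expr0 mul1r big1 ?addr0 => [|s _]; last by rewrite expr0n mul0r.
  have -> : - (col' j w0 *m row' j A) = w0 0 j *: row j A.
    apply/rowP => l; have /rowP/(_ l) := w0A; rewrite !mxE (bigD1_ord j) //=.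
    move/eqP; rewrite addr_eq0 => /eqP ->; congr (- _).
    by apply: eq_bigr => i _; rewrite !mxE.
  by rewrite w0j.
apply: filterS (nz (fun x => S x.2.1 x.1) _ _ S0) => [x xS _ _ //|].
rewrite /S; apply: cvg_bigsum => s; apply: cvgM; first exact: cvg_exprn.
apply: cvg_meval => i; apply: cvg_pack => // l.
rewrite mxE; under eq_fun do rewrite mxE.
apply: cvgN; apply: cvg_mulmx_entry => u v; last exact: cvg_cst.
by rewrite (ord1 u) mxE; under eq_fun do rewrite mxE; exact: cw.
Qed.

(** * Embedding in a small box and the construction over a general field *)

Definition squash (F : numFieldType) (x : F) : F := x / (1 + `|x|).

Lemma squash_lt1 (F : numFieldType) (x : F) : `|squash x| < 1.
Proof.
have x1 : 0 < 1 + `|x| by rewrite ltr_pwDl.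
by rewrite normrM normfV (gtr0_norm x1) ltr_pdivrMr // mul1r ltrDr.
Qed.

(** Since [1 - |squash x|] is the inverse of [1 + |x|], the value [squash x] determines the
    denominator and then [x]. *)
Lemma squash_inj (F : numFieldType) : injective (@squash F).
Proof.
have pos (x : F) : 0 < 1 + `|x| by rewrite ltr_pwDl.
have den (x : F) : (1 + `|x|)^-1 = 1 - `|squash x|.
  rewrite normrM normfV (gtr0_norm (pos x)).
  by rewrite -[X in _ = X - _](divff (lt0r_neq0 (pos x))) -mulrBl addrK mul1r.
move=> x y xy; have : (1 + `|x|)^-1 = (1 + `|y|)^-1 by rewrite !den xy.
move=> denxy; move: xy; rewrite /squash denxy.
by apply: mulIf; rewrite invr_neq0 // lt0r_neq0.
Qed.

Lemma squash_continuous (F : numFieldType) (x : F) :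
  (fun y : F => squash y) @ x --> squash x.
Proof.
have x0 : 1 + `|x| != 0 by rewrite lt0r_neq0 // ltr_pwDl.
have cx : (fun y : F => y) @ x --> x by exact: cvg_id.
exact: (cvgM cx (cvgV x0 (cvgD (cvg_cst (1 : F)) (cvg_norm cx)))).
Qed.

Lemma near_box (F : numFieldType) m (P : F * 'rV[F]_m -> Prop) :
  (\forall v \near nbhs (0 : F * 'rV[F]_m), P v) ->
  exists2 d : F, 0 < d & forall (t : F) (p : 'rV[F]_m),
    `|t| < d -> (forall b, `|p 0 b| < d) -> P (t, p).
Proof.
move=> /nbhs_ballP[d d0 dP]; exists d => // t p td pd; apply: dP.
split => /=; first by rewrite -ball_normE /ball_ /= sub0r normrN.
split=> // i b; rewrite -ball_normE /ball_ /= mxE sub0r normrN ord1; exact: pd.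
Qed.

(** The order of [F] may be partial, but norms are real, hence comparable, and a maximum exists. *)
Lemma max_entry (F : numFieldType) L (w : 'rV[F]_L) : w != 0 ->
  exists2 j, w 0 j != 0 & forall l, `|w 0 l| <= `|w 0 j|.
Proof.
case/rV0Pn => j0 wj0.
have [] := @real_arg_maxP _ _ j0 xpredT (fun l => `|w 0 l|) isT.
  by move=> l _; exact: normr_real.
move=> j _ jP; exists j => [|l]; last exact: jP.
by rewrite -normr_gt0 (lt_le_trans _ (jP j0 isT)) ?normr_gt0.
Qed.

(** A nontrivial dependence yields a normalised [w] that satisfies the relation of
    [pointed_relation], which [near_no_dependence] excludes close to 0. Local compactness of [F]
    enters through the hypothesis that closed discs lie in compact sets, so the real and complex
    cases are handled together. *)
Lemma independent_near0 (F : numFieldType) m k :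
  (forall r : F, exists2 K, compact K & forall x : F, `|x| <= r -> K x) ->
  exists2 d : F, 0 < d &
  exists A : 'M[F]_(#|{ffun 'I_m -> 'I_k.+2}|, m.+1 * k.+1),
  forall u : 'I_k.+2 -> 'rV[F]_m, injective u -> (forall i b, `|u i 0 b| < d) ->
  forall c : 'I_k.+2 -> F, \sum_i c i *: (veronese k.+2 (u i) *m A) = 0 ->
  forall i, c i = 0.
Proof.
move=> cpt; pose N := (m.+1 * k.+1)%N.
set L := #|_|.
(* One relation for each coordinate [b] in which the first two points may differ and each position
   [j] of a largest entry of [w]. The family is finite, so one [A] and one box serve all cases. *)
pose I := ('I_m * 'I_L)%type.
pose rel (b : 'I_m) (j : 'I_L) e (H : nat -> mpoly (1 + N + L.-1 * N) F) :=
  forall c (q : 'M[F]_(k.+1, m)) (A : 'M[F]_(L, N)),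
  let w := pointed_sum c q in q ord0 b != 0 ->
    \sum_(s < e.+1) q ord0 b ^+ s *
      meval (pack (w 0 j) (- (col' j w *m row' j A)) (row' j A) 0) (H s) = 0.
have /fin_all_exists[e] : forall i : I, exists e,
    exists H : nat -> mpoly (1 + N + L.-1 * N) F, H 0%N != 0 /\ rel i.1 i.2 e H.
  move=> i; have [e [H H0 Hrel]] := pointed_relation F ord0 i.1 i.2.
  by exists e, H.
move=> /fin_all_exists[H /all_and2[H0 Hrel]].
have [y0 [A [y00 Hy]]] := generic_matrix snd H0.
have [K cK KP] := cpt `|y0|.
have near_i i := near_no_dependence (e i) (H := H i) cK (Hy i).
have [d d0 dP] := near_box (filter_forall _ near_i).
(* Halving keeps differences of points, not only the points, below [d]. *)
have d2 : 0 < d / 2 by rewrite divr_gt0.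
exists (d / 2) => //; exists A => u u_inj ud c sum0.
have ud' i b : `|u i 0 b| < d.
  by apply: lt_trans (ud i b) _; rewrite ltr_pdivrMr // ltr_pMr // ltr1n.
pose q : 'M[F]_(k.+1, m) := \matrix_(i, b) (u (lift ord0 i) 0 b - u ord0 0 b).
pose cr : 'rV[F]_k.+2 := \row_i c i.
have qE i : row i q = u (lift ord0 i) - u ord0 by apply/rowP => b; rewrite !mxE.
pose w := pointed_sum cr q.
have wE : w = \sum_i c i *: veronese k.+2 (u i - u ord0).
  rewrite big_ord_recl subrr /w /pointed_sum mxE; congr (_ + _).
  by apply: eq_bigr => i _; rewrite mxE qE.
have wA : w *m (translation k.+2 (u ord0) *m A) = 0.
  rewrite -[RHS]sum0 mulmxA wE !mulmx_suml; apply: eq_bigr => i _.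
  by rewrite -!scalemxAl -veronese_translation subrK.
(* If [w = 0], independence of the Veronese vectors already gives [c = 0]; otherwise a contradiction
   is derived. *)
have [w0|/max_entry[j wj wmax]] := eqVneq w 0.
  apply: (@veronese_indep _ _ _ (fun i => u i - u ord0)); last by rewrite -wE.
  by move=> i i' /addIr /u_inj.
have /rV0Pn[b qb] : row ord0 q != 0.
  by rewrite qE subr_eq0 (inj_eq u_inj).
rewrite mxE in qb.
(* Scaling by [a] makes a largest entry equal to [y0], so all entries have norm at most [|y0|] and
   lie in [K]. *)
pose a := y0 / w 0 j.
have waE : pointed_sum (a *: cr) q = a *: w.
  rewrite /w /pointed_sum scalerDr mxE scalerA scaler_sumr; congr (_ + _).
  by apply: eq_bigr => i _; rewrite mxE scalerA.
have waj : (a *: w) 0 j = y0 by rewrite mxE divfK.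
have := Hrel (b, j) (a *: cr) q A qb; rewrite waE => relw.
have qbd : `|q ord0 b| < d.
  rewrite mxE [ltRHS](splitr d); apply: le_lt_trans (ler_normB _ _) _.
  exact: ltrD.
have := dP (q ord0 b) (u ord0) qbd (ud' ord0) (b, j) (a *: w).
case/(_ _ _ _)/negP => [l| // | | ]; last by rewrite /= relw.
  apply: KP; rewrite mxE normrM normrM normfV -mulrA ler_piMr // mulrC.
  by rewrite ler_pdivrMr ?normr_gt0 // mul1r.
by rewrite /= -scalemxAl wA scaler0.
Qed.

Lemma k_regular_exists (F : numFieldType) m k : (2 <= k)%N ->
  (forall r : F, exists2 K, compact K & forall x : F, `|x| <= r -> K x) ->
  exists f : 'rV[F]_m -> 'rV[F]_(m.+1 * k.-1), continuous f /\ k_regular k f.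
Proof.
case: k => [//|[//|k]] _ cpt.
have [d d0 [A Aindep]] := independent_near0 m k cpt.
(* Scaled coordinatewise squashing embeds the whole space in the box of radius [d]. *)
pose s (x : 'rV[F]_m) : 'rV[F]_m := \row_b (d * squash (x 0 b)).
exists (fun x => veronese k.+2 (s x) *m A); split.
  move=> x; apply: (@cvg_entries F _ (nbhs x)) => i0 l0 /=.
  apply: cvg_mulmx_entry => i l; last exact: cvg_cst.
  rewrite mxE; under eq_fun do rewrite mxE.
  apply: cvg_bigprod => b; apply: cvg_exprn.
  rewrite mxE; under eq_fun do rewrite mxE.
  apply: cvgM; first exact: cvg_cst.
  exact: (cvg_comp _ _ (@coord_continuous F 1 m 0 b x) (@squash_continuous F _)).
move=> p p_inj.
apply/(@freeP _ _ _ [tuple veronese k.+2 (s (p i)) *m A | i < k.+2]) => c sum0.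
apply: (Aindep (s \o p)) => [|i b|].
- move=> i i' /rowP sii'; apply/p_inj/rowP => b; apply: squash_inj.
  by have := sii' b; rewrite !mxE => /mulfI; apply; rewrite lt0r_neq0.
- by rewrite mxE normrM gtr0_norm // gtr_pMr // squash_lt1.
rewrite -[RHS]sum0; apply: eq_bigr => i _.
by rewrite (nth_map ord0) ?size_enum_ord // nth_ord_enum.
Qed.

(** * Compact sets containing the real and complex discs *)

Lemma real_exhaustion (R : realType) (r : R) :
  exists2 K, compact K & forall x : R, `|x| <= r -> K x.
Proof.
exists `[- r, r]; first exact: segment_compact.
by move=> x; rewrite ler_norml /= in_itv.
Qed.

Lemma cvg_complex (R : realType) (a : R) :
  (fun x : R => x%:C) @ a --> (a%:C : (R[i] : numFieldType)).
Proof.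
apply/(@cvgrPdist_lt _ (R[i] : numFieldType)) => e e0.
(* A positive element of [R[i]] is real, so the estimate can be made in [R]. *)
have eE : e = (complex.Re e)%:C by case: e e0 => x y; rewrite ltcE /= => /andP[/eqP -> _].
rewrite eE ltcR in e0.
near=> x.
rewrite eE -rmorphB /= normc_def /= expr0n addr0 sqrtr_sqr ltcR.
by near: x; exact: cvgr_dist_lt.
Unshelve. all: by end_near. Qed.

Lemma complex_exhaustion (R : realType) (r : R[i]) :
  exists2 K : set (R[i] : numFieldType), compact K & forall x, `|x| <= r -> K x.
Proof.
(* Norms are real, so [|x| <= r] forces [r] to be real; for any other [r] there is no such [x], and
   the real part suffices. *)
pose rho := complex.Re r.
pose f (ab : R * R) : (R[i] : numFieldType) := ab.1%:C + 'i%C * ab.2%:C.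
exists (f @` (`[- rho, rho] `*` `[- rho, rho])).
  apply: continuous_compact; last by apply: compact_setX; exact: segment_compact.
  apply: continuous_subspaceT => ab; apply: cvgD.
    exact: (cvg_comp _ _ cvg_fst (@cvg_complex R _)).
  apply: cvgM; first exact: cvg_cst.
  exact: (cvg_comp _ _ cvg_snd (@cvg_complex R _)).
move=> x xr.
have ReP (y : R) : y%:C <= r -> y <= rho.
  by rewrite /rho; case: (r) => a b; rewrite lecE => /andP[].
exists (complex.Re x, complex.Im x); last by rewrite /f /= -complexE.
split; rewrite /= in_itv /= -ler_norml; apply/ReP/(le_trans _ xr).
  exact: normc_ge_Re.
by case: x {xr} => a b; rewrite normc_def lecR -sqrtr_sqr ler_wsqrtr // lerDr sqr_ge0.
Qed.
Unset Implicit Arguments.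

Theorem theorem1p2 (R : realType) (m k : nat) :
  (1 <= m)%N -> (2 <= k)%N ->
  (exists f : 'rV[R]_m -> 'rV[R]_((m.+1) * (k.-1)),
      continuous f /\ k_regular k f) /\
  (exists g : 'rV[(R[i])^o]_m -> 'rV[(R[i])^o]_((m.+1) * (k.-1)),
      continuous g /\ k_regular k g).
Proof.
move=> _ k2; split; first exact: k_regular_exists k2 (@real_exhaustion R).
exact: (k_regular_exists m k2 (@complex_exhaustion R)).
Qed.
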